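(* Let $A\in C^\alpha(\Sigma^+,\mathbb{R})$ with $0<\alpha\le1$, and for each $t\in\mathbb{R}$ let $\hat\mu_t$ be the equilibrium state for $tA$. Suppose that the maximizing measure $\mu_A$ for $A$ is unique and that $A>0$. Then $\mu_A=\lim_{t\to+\infty}\hat\mu_t$ in the weak* topology.
   Context: $\Sigma^+$ is a one-sided topologically mixing subshift of finite type (the sequences $\mathbf{x}=(x_0,x_1,\ldots)$ over a finite alphabet all of whose consecutive pairs $(x_i,x_{i+1})$ are allowed by a 0-1 transition matrix), with shift map $\sigma:\Sigma^+\to\Sigma^+$. Fix $\lambda>1$ and endow $\Sigma^+$ with the metric $d(\mathbf{x},\mathbf{y})=\lambda^{-n}$, $n=\min\{k\ge 0: x_k\ne y_k\}$ (and $d(\mathbf{x},\mathbf{x})=0$). $C^\alpha(\Sigma^+,\mathbb{R})$ is the space of $\alpha$-Hölder continuous functions $A:\Sigma^+\to\mathbb{R}$. A maximizing measure for $A$ is a $\sigma$-invariant Borel probability $\mu$ with $\int A\,d\mu=\max\{\int A\,d\nu:\nu\ \sigma\text{-invariant Borel probability}\}$. The equilibrium state for $tA$ is the unique $\sigma$-invariant Borel probability attaining the maximum in $P(tA)=\max_\nu\big(h(\nu)+t\int A\,d\nu\big)$, where $\nu$ ranges over $\sigma$-invariant Borel probabilities and $h(\nu)$ is the metric entropy. *)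

(* Defs.v *)
From HB Require Import structures.
From mathcomp Require Import all_boot all_order all_algebra.
From mathcomp Require Import all_classical all_reals all_analysis.

Set Implicit Arguments.
Unset Strict Implicit.
Unset Printing Implicit Defensive.

Import Order.TTheory GRing.Theory Num.Theory.
Import numFieldNormedType.Exports.

Local Open Scope classical_set_scope.
Local Open Scope ring_scope.

Definition admissible (S : finType) (M : rel S) (x : nat -> S) : Prop :=
  forall i, M (x i) (x i.+1).

(* The proof that some admissible sequence exists and the base of the metric
   are parameters of the type: measurable types are pointed in the library, and
   the metric structure below is attached to the type. *)
Record subshift (R : realType) (S : finType) (M : rel S)
    (M0 : exists x, admissible M x) (lam : R) (lam1 : 1 < lam) := Subshift {
  subshift_seq :> nat -> S ;
  subshift_admissible : admissible M subshift_seq }.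

Section subshift_theory.
Context (R : realType) (S : finType) (M : rel S).
Context (M0 : exists x, admissible M x) (lam : R) (lam1 : 1 < lam).
Local Notation X := (subshift M0 lam1).
Implicit Types x y z : X.

HB.instance Definition _ := gen_eqMixin X.
HB.instance Definition _ := gen_choiceMixin X.
HB.instance Definition _ := isPointed.Build X
  (@Subshift R S M M0 lam lam1 (projT1 (cid M0)) (projT2 (cid M0))).

Definition subshift_dist x y : R :=
  if pselect (exists k, x k != y k) is left xy then lam ^- ex_minn xy else 0.

Lemma subshift_eq x y : (forall k, x k = y k) -> x = y.
Proof.
case: x y => [x hx] [y hy] /= /funext xy; move: hx hy; rewrite xy => hx hy.
by congr Subshift; exact: Prop_irrelevance.
Qed.

Lemma subshift_dist_lt x y n :
  (subshift_dist x y < lam ^- n) <-> (forall k, (k <= n)%N -> x k = y k).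
Proof.
have lam0 : 0 < lam by rewrite (lt_trans _ lam1).
rewrite /subshift_dist; case: pselect => [xy|xy]; last first.
  split=> [_ k _|_]; last by rewrite invr_gt0 exprn_gt0.
  by apply/eqP/negPn/negP => xyk; apply: xy; exists k.
case: ex_minnP => m xym mmin.
rewrite ltf_pV2 ?posrE ?exprn_gt0// ltr_eXn2l//; split=> [nm k kn|h].
  apply/eqP/negPn/negP => /mmin; rewrite leqNgt => /negP; apply.
  exact: leq_ltn_trans nm.
by rewrite ltnNge; apply/negP => /h /eqP; exact/negP.
Qed.

Lemma subshift_distxx x : subshift_dist x x = 0.
Proof.
rewrite /subshift_dist; case: pselect => // xx.
by exfalso; case: xx => k /eqP.
Qed.

Lemma subshift_dist_ge0 x y : 0 <= subshift_dist x y.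
Proof.
rewrite /subshift_dist; case: pselect => // xy.
by rewrite invr_ge0 exprn_ge0// ltW// (lt_trans _ lam1).
Qed.

Lemma subshift_dist_eq0 x y : subshift_dist x y = 0 -> x = y.
Proof.
move=> xy0; apply: subshift_eq => k.
apply: (subshift_dist_lt x y k).1 (leqnn k).
by rewrite xy0 invr_gt0 exprn_gt0// (lt_trans _ lam1).
Qed.

Lemma subshift_dist_sym x y : subshift_dist x y = subshift_dist y x.
Proof.
wlog suff : x y / subshift_dist x y <= subshift_dist y x.
  by move=> h; apply/eqP; rewrite eq_le !h.
rewrite {1}/subshift_dist; case: pselect => [xy|_].
  case: ex_minnP => m xym _; rewrite leNgt; apply/negP => /subshift_dist_lt h.
  by move: xym; rewrite h// eqxx.
exact: subshift_dist_ge0.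
Qed.

Lemma subshift_dist_triangle y x z :
  subshift_dist x z <= subshift_dist x y + subshift_dist y z.
Proof.
rewrite {1}/subshift_dist; case: pselect => [xz|_]; last first.
  by rewrite addr_ge0// subshift_dist_ge0.
case: ex_minnP => m xzm _; rewrite leNgt; apply/negP => h.
have /subshift_dist_lt xy : subshift_dist x y < lam ^- m.
  by rewrite (le_lt_trans _ h)// lerDl subshift_dist_ge0.
have /subshift_dist_lt yz : subshift_dist y z < lam ^- m.
  by rewrite (le_lt_trans _ h)// lerDr subshift_dist_ge0.
by move: xzm; rewrite xy// yz// eqxx.
Qed.

HB.instance Definition _ := isMetric.Build R X subshift_distxx
  subshift_dist_eq0 subshift_dist_sym subshift_dist_triangle.

Definition shift_map x : X :=
  @Subshift R S M M0 lam lam1 (fun i => x i.+1)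
    (fun i => subshift_admissible x i.+1).

End subshift_theory.

Arguments subshift_dist {R S M M0 lam lam1} x y.
Arguments shift_map {R S M} M0 {lam} lam1 x.

Definition topologically_mixing (X : topologicalType) (f : X -> X) : Prop :=
  forall U V : set X, open U -> open V -> U !=set0 -> V !=set0 ->
  exists N, forall n, (N <= n)%N -> (iter n f @` U) `&` V !=set0.

Definition hoelder_continuous (R : realType) (X : metricType R) (alpha : R)
    (A : X -> R) : Prop :=
  exists C : R, forall x y : X, `|A x - A y| <= C * mdist x y `^ alpha.

Definition borel (X : ptopologicalType) := g_sigma_algebraType (@open X).

Section thermodynamic_formalism.
Context (R : realType) (X : ptopologicalType) (f : X -> X).
Implicit Types mu nu : probability (borel X) R.

Definition invariant_measure mu : Prop :=
  forall B : set (borel X), measurable B -> mu (f @^-1` B) = mu B.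

(* A finite measurable partition into k (possibly empty) cells is encoded by
   its labelling map p : X -> 'I_k. *)
Definition measurable_partition k (p : X -> 'I_k) : Prop :=
  forall i, measurable (p @^-1` [set i] : set (borel X)).

(* The cell labelled w of the join of p, p \o f, ..., p \o f^(n-1). *)
Definition join_cell k (p : X -> 'I_k) n (w : n.-tuple 'I_k) : set X :=
  [set x | forall i : 'I_n, p (iter i f x) = tnth w i].

(* Null cells contribute 0, as 0 * ln 0 = 0. *)
Definition join_entropy mu k (p : X -> 'I_k) n : R :=
  - \sum_(w : n.-tuple 'I_k)
      fine (mu (join_cell p w)) * ln (fine (mu (join_cell p w))).

(* The limit exists, by subadditivity, when mu is f-invariant. *)
Definition partition_entropy mu k (p : X -> 'I_k) : R :=
  limn (fun n => join_entropy mu p n / n%:R).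

Definition metric_entropy mu : \bar R :=
  ereal_sup [set h | exists k (p : X -> 'I_k),
    measurable_partition p /\ h = (partition_entropy mu p)%:E].

Definition maximizing_measure (A : X -> R) mu : Prop :=
  invariant_measure mu /\
  forall nu, invariant_measure nu -> \int[nu]_x A x <= \int[mu]_x A x.

(* Measures are set functions on all of set X, only constrained on measurable
   sets; hence uniqueness is up to equality on measurable sets. *)
Definition unique_maximizing_measure (A : X -> R) mu : Prop :=
  maximizing_measure A mu /\
  forall nu, maximizing_measure A nu ->
    forall B : set (borel X), measurable B -> nu B = mu B.

(* The pressure P(tA). *)
Definition pressure (A : X -> R) (t : R) : \bar R :=
  ereal_sup [set (metric_entropy nu + (t * \int[nu]_x A x)%:E)%E
            | nu in invariant_measure].

(* Equilibrium states for tA. *)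
Definition equilibrium_state (A : X -> R) (t : R) mu : Prop :=
  invariant_measure mu /\
  (metric_entropy mu + (t * \int[mu]_x A x)%:E)%E = pressure A t.

End thermodynamic_formalism.

(* Meant for compact X, where continuous functions are bounded. *)
Definition weakstar_cvg (R : realType) (X : ptopologicalType) (I : Type)
    (F : set_system I) (mu : I -> probability (borel X) R)
    (nu : probability (borel X) R) : Prop :=
  forall g : X -> R, continuous g ->
    (\int[mu i]_x g x) @[i --> F] --> \int[nu]_x g x.

(* Main.v *)
Require Import Defs.
From HB Require Import structures.
From mathcomp Require Import all_boot all_order all_algebra.
From mathcomp Require Import ring lra.
From mathcomp Require Import all_classical all_reals all_analysis.
Set Implicit Arguments.
Unset Strict Implicit.
Unset Printing Implicit Defensive.

Import Order.TTheory GRing.Theory Num.Theory.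
Import numFieldNormedType.Exports.
Local Open Scope classical_set_scope.
Local Open Scope ring_scope.

(** As t grows, the energy term t * \int A dominates the entropy in the
    variational principle, so equilibrium states for t A nearly maximize the
    integral of A; compactness and uniqueness of the maximizing measure then
    force convergence.

    In detail, comparing the equilibrium state mu_t with muA in the supremum
    that defines the pressure gives
      h(muA) + t \int A dmuA <= h(mu_t) + t \int A dmu_t.
    The entropy of all invariant measures is bounded by one constant
    ([metric_entropy_le]), so \int A dmu_t >= \int A dmuA - K / t
    ([equilibrium_energy]).  If mu_t did not converge to muA weakly*, some
    continuous g would separate \int g dmu_t from \int g dmuA along some
    ultrafilter U on the t's converging to +oo.  Along U the measures mu_t
    converge on every cylinder set, and the limits extend to an invariant Borel
    probability nu ([ultralimit_probability], [ultralimit_invariant]).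
    Continuous functions are uniform limits of functions of finitely many
    coordinates, so their integrals converge along U to the integral against nu
    ([Rintegral_ultralimit]).  Applied to A, this shows that nu is maximizing
    ([maximizing_ultralimit]), hence equal to muA; applied to g, it then
    contradicts the choice of U.

    The entropy bound must be uniform over all measurable partitions p, not
    only those into cylinders. Measurable sets being approximable by
    cylinders, p coincides up to a set of small measure with a map p'
    depending on finitely many coordinates, say m
    ([partition_cylinder_approx]). The p-itinerary of length n of a point can
    then be encoded by its first n + m letters, which determine the
    p'-itinerary, together with a correction at the few times where p and p'
    differ. In place of conditional entropy and the theorem on generating
    partitions, the length of this code is compared with the entropy by Gibbs'
    inequality ([gibbs_inequality]), the code being turned into the explicit
    probability weights [code_weight]. *)

(** * Ultrafilters and integrals of finitely valued functions *)

Lemma ultra_finite_value (T : Type) (U : set_system T) (I : finType)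
    (a : T -> I) :
  UltraFilter U -> exists i, \forall t \near U, a t = i.
Proof.
move=> UU; apply: contrapT => /forallNP noi.
have /filter_forall /filter_ex[t /(_ (a t))] :
    forall i, \forall t \near U, a t <> i.
  by move=> i; have [/noi|] := in_ultra_setVsetC [set t | a t = i] UU.
exact.
Qed.

(** Ultrafilters replace the extraction of subsequences: every bounded family
    converges along them, and all these limits exist simultaneously. *)
Lemma ultra_bounded_cvg (R : realType) (T : Type) (U : set_system T)
    (a b : R) (g : T -> R) :
  UltraFilter U -> (forall t, a <= g t <= b) -> cvg (g @ U).
Proof.
move=> UU gab.
have gUab : (g @ U) `[a, b]%classic.
  by apply: (@filterE T U) => t /=; rewrite in_itv; exact: gab.
have [l [_ ll]] := segment_compact _ gUab.
apply/cvg_ex; exists l => V lV.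
have [//|nV] := in_ultra_setVsetC (g @^-1` V) UU.
have [y [/= nVy Vy]] := ll (~` V) V nV lV.
by [].
Qed.

(** Gibbs' inequality: since ln x <= x - 1, every subprobability q yields an
    upper bound for the entropy of the probability a. *)
Lemma gibbs_inequality (R : realType) (I : finType) (a q : I -> R) :
  (forall i, 0 <= a i) -> (forall i, 0 < q i) ->
  \sum_i a i = 1 -> \sum_i q i <= 1 ->
  - (\sum_i a i * ln (a i)) <= - (\sum_i a i * ln (q i)).
Proof.
move=> a0 q0 a1 q1; rewrite lerN2 -subr_ge0 -sumrB.
apply: (@le_trans _ _ (\sum_i (a i - q i))).
  by rewrite sumrB a1 subr_ge0.
apply: ler_sum => i _; have := a0 i; rewrite le_eqVlt => /predU1P[<-|ai0].
  by rewrite !mul0r subrr sub0r oppr_le0 ltW.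
have qa : q i / a i > 0 by rewrite divr_gt0.
have : ln (q i / a i) <= q i / a i - 1.
  have := @le_ln1Dx R (q i / a i - 1).
  by rewrite addrCA subrr addr0; apply; lra.
rewrite ln_div ?posrE// => h.
have : a i * (ln (q i) - ln (a i)) <= a i * (q i / a i - 1).
  by rewrite ler_pM2l.
rewrite [leRHS]mulrBr mulr1 mulrCA divff ?gt_eqF// mulr1.
lra.
Qed.

Section finite_label.
Context {R : realType} {d} {T : measurableType d} (mu : probability T R).

Lemma probability_bounded_integrable (g : T -> R) :
  measurable_fun [set: T] g -> (exists C, forall x, `|g x| <= C) ->
  mu.-integrable [set: T] (EFin \o g).
Proof.
move=> mg [C gC]; apply: measurable_bounded_integrable => //.
  by rewrite [X in (X < _)%E](@probability_setT _ _ _ mu) ltry.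
exists C; split; first exact: num_real.
by move=> M CM x _ /=; rewrite (le_trans (gC x))// ltW.
Qed.

Context {I : finType} (lab : T -> I).
Hypothesis mlab : forall i, measurable (lab @^-1` [set i]).

Lemma measurable_label (c : I -> R) :
  measurable_fun [set: T] (c \o lab).
Proof.
move=> _ Y mY; rewrite setTI.
rewrite [X in measurable X](_ : _ =
    \bigcup_(i in [set i | Y (c i)]) (lab @^-1` [set i])).
  by apply: fin_bigcup_measurable => //; exact: finite_finset.
by apply/seteqP; split=> [x Yx|x [i /= Yi lx]]; [exists (lab x)|rewrite /= lx].
Qed.

Lemma integrable_label (c : I -> R) :
  mu.-integrable [set: T] (EFin \o (c \o lab)).
Proof.
apply: probability_bounded_integrable; first exact: measurable_label.
exists (\sum_i `|c i|) => x.
by rewrite (bigD1 (lab x))//= lerDl sumr_ge0.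
Qed.

(** Change of variables for a finitely valued map: sums against the masses of
    the cells of a partition become integrals, which can be compared
    pointwise. *)
Lemma Rintegral_label (c : I -> R) :
  \int[mu]_x c (lab x) = \sum_i c i * fine (mu (lab @^-1` [set i])).
Proof.
rewrite /Rintegral.
rewrite (eq_integral (fun x =>
    \sum_i (c i)%:E * (\1_(lab @^-1` [set i]) x)%:E)%E); last first.
  move=> x _; rewrite (bigD1 (lab x))//= big1 => [|i ilab].
    by rewrite indicE mem_set// mule1 adde0.
  by rewrite indicE memNset ?mule0// => /= li; rewrite -li eqxx in ilab.
have intc i : mu.-integrable [set: T]
    (fun x => (c i)%:E * (\1_(lab @^-1` [set i]) x)%:E)%E.
  by apply: integrableZl => //; exact: integrable_indic.
rewrite integral_sum//=.
rewrite -[RHS]/(fine _%:E) -sumEFin; congr fine; apply: eq_bigr => i _.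
rewrite integralZl//; last exact: integrable_indic.
by rewrite integral_indic// setIT EFinM fineK// fin_num_measure.
Qed.

End finite_label.

Lemma Rintegral_near (R : realType) d (T : measurableType d)
    (mu : probability T R) (g h : T -> R) (e : R) :
  mu.-integrable [set: T] (EFin \o g) -> mu.-integrable [set: T] (EFin \o h) ->
  (forall x, `|g x - h x| <= e) ->
  `|\int[mu]_x g x - \int[mu]_x h x| <= e.
Proof.
move=> ig ih gh; rewrite -RintegralB//.
have igh : mu.-integrable [set: T] (EFin \o (g \- h)).
  by have := integrableB measurableT ig ih; apply: eq_integrable => // x _ /=.
rewrite (le_trans (le_normr_Rintegral _ igh))//.
rewrite [leRHS](_ : e = \int[mu]_(_ in [set: T]) e); last first.
  by rewrite Rintegral_cst// [X in fine X]probability_setT mulr1.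
apply: le_Rintegral => //.
- exact: (integrable_norm igh).
- exact: finite_measure_integrable_cst.
- by move=> x _; exact: gh.
Qed.

Lemma measure_le_sum (R : realType) d (T : measurableType d)
    (mu : {measure set T -> \bar R}) (I : finType) (A : set T) (F : I -> set T) :
  measurable A -> (forall i, measurable (F i)) -> A `<=` \bigcup_i F i ->
  (mu A <= \sum_i mu (F i))%E.
Proof.
move=> mA mF AF; rewrite fsbig_seq ?index_enum_uniq//=.
apply: content_sub_fsum => //.
by move=> x /AF[i _ Fx]; exists i => //=; rewrite mem_index_enum.
Qed.

Lemma label_mass (R : realType) d (T : measurableType d)
    (mu : probability T R) (I : finType) (lab : T -> I) :
  (forall i, measurable (lab @^-1` [set i])) ->
  \sum_i fine (mu (lab @^-1` [set i])) = 1.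
Proof.
move=> mlab; have := Rintegral_label mu mlab (fun=> 1).
rewrite Rintegral_cst// [X in _ * fine X]probability_setT mulr1 => ->.
by apply: eq_bigr => i _; rewrite mul1r.
Qed.

Lemma Rintegral_sum (R : realType) d (T : measurableType d)
    (mu : probability T R) n (h : 'I_n -> T -> R) :
  (forall i, mu.-integrable [set: T] (EFin \o h i)) ->
  mu.-integrable [set: T] (EFin \o (fun x => \sum_i h i x)) /\
  \int[mu]_x (\sum_i h i x) = \sum_i \int[mu]_x h i x.
Proof.
move=> ih; split.
  rewrite (_ : EFin \o _ = fun x => (\sum_i (EFin \o h i) x)%E); last first.
    by apply/funext => x /=; rewrite sumEFin.
  exact: integrable_sum.
rewrite sum_fine; last by move=> i _; exact: integrable_fin_num (ih i).
rewrite -(integral_sum measurableT ih); congr fine.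
by apply: eq_integral => x _; rewrite sumEFin.
Qed.

(** * Cylinders and compactness of the subshift *)

Section cylinders.
Context {R : realType} {S : finType} {M : rel S}.
Context {M0 : exists x, admissible M x} {lam : R} {lam1 : 1 < lam}.
Local Notation X := (subshift M0 lam1).
Local Notation sigma := (shift_map M0 lam1).

Definition agree (m : nat) (x y : X) : Prop := forall i, (i < m)%N -> x i = y i.

(** Applied to [V := Prop], this says that a set is determined by the first
    [m] coordinates. *)
Definition depends_on {V : Type} (m : nat) (g : X -> V) : Prop :=
  forall x y, agree m x y -> g x = g y.

Definition cylinder (D : set X) : Prop := exists m, depends_on m D.

Lemma agree_sym m x y : agree m x y -> agree m y x.
Proof. by move=> xy i im; rewrite xy. Qed.

Lemma agreeW m n x y : (m <= n)%N -> agree n x y -> agree m x y.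
Proof. by move=> mn xy i im; rewrite xy// (leq_trans im). Qed.

Lemma iter_shiftE n (x : X) i : iter n sigma x i = x (i + n)%N.
Proof. by elim: n i => [|n ih] i /=; rewrite ?addn0// ih addnS. Qed.

Lemma agree_iter m n x y :
  agree (n + m) x y -> agree m (iter n sigma x) (iter n sigma y).
Proof.
by move=> xy i im; rewrite !iter_shiftE; apply: xy; rewrite addnC ltn_add2l.
Qed.

Lemma cylinder_preimage {V} m (g : X -> V) (D : set V) :
  depends_on m g -> cylinder (g @^-1` D).
Proof. by move=> gm; exists m => x y xy; rewrite /preimage/= (gm _ _ xy). Qed.

Lemma cylinder0 : cylinder set0. Proof. by exists 0%N. Qed.

Lemma cylinderC D : cylinder D -> cylinder (~` D).
Proof. by case=> m Dm; exists m => x y /Dm; rewrite /setC/mkset => ->. Qed.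

Lemma cylinderT : cylinder [set: X].
Proof. by exists 0%N. Qed.

Lemma cylinderU D E : cylinder D -> cylinder E -> cylinder (D `|` E).
Proof.
move=> [m Dm] [n En]; exists (maxn m n) => x y xy.
rewrite /setU/mkset (Dm x y) 1?(En x y)//.
  by apply: agreeW xy; rewrite leq_maxr.
by apply: agreeW xy; rewrite leq_maxl.
Qed.

Lemma cylinderI D E : cylinder D -> cylinder E -> cylinder (D `&` E).
Proof.
move=> cD cE; rewrite -[D `&` E]setCK setCI.
by apply: cylinderC; apply: cylinderU; exact: cylinderC.
Qed.

Lemma cylinder_shift D : cylinder D -> cylinder (sigma @^-1` D).
Proof.
move=> [m Dm]; exists m.+1 => x y xy; apply: Dm.
exact: (@agree_iter m 1).
Qed.

(** Compactness of the subshift in combinatorial form. If no finite part of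
    the family covers, pick x_N outside the first N sets; along an ultrafilter
    every coordinate of x_N is eventually constant because the alphabet is
    finite, and the sequence of these constants is a point that no D i
    contains. *)
Lemma cylinder_finite_subcover (D : (set X)^nat) :
  (forall i, cylinder (D i)) -> (forall x, exists i, D i x) ->
  exists N, forall x, exists2 i, (i < N)%N & D i x.
Proof.
move=> cD DT; apply: contrapT => noN.
have /choice[x_ xD] : forall N, exists x, forall i, (i < N)%N -> ~ D i x.
  move=> N; apply: contrapT => nox; apply: noN; exists N => x.
  apply: contrapT => noi; apply: nox; exists x => i iN Dix.
  by apply: noi; exists i.
have [U [UU ooU]] := ultraFilterLemma (eventually_filter).
have PU : ProperFilter U by exact: ultra_proper.
have /choice[s xs] : forall k, exists s, \forall n \near U, x_ n k = s.
  by move=> k; exact: ultra_finite_value.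
have adm : admissible M s.
  move=> k.
  have /filter_ex[n [<- <-]] : U [set n | x_ n k = s k /\ x_ n k.+1 = s k.+1].
    by apply: filterI; exact: xs.
  exact: subshift_admissible.
pose x : X := @Subshift R S M M0 lam lam1 s adm.
have [i Dix] := DT x; have [m Dm] := cD i.
have agm : \forall n \near U, agree m (x_ n) x.
  have : \forall n \near U, forall k : 'I_m, x_ n k = s k.
    by apply: filter_forall => k; exact: xs.
  by apply: filterS => n h k km; exact: (h (Ordinal km)).
have Ui : \forall n \near U, (i < n)%N.
  by apply: ooU; exists i.+1.
have /filter_ex[n [nx /xD]] : U [set n | agree m (x_ n) x /\ (i < n)%N].
  exact: filterI.
by rewrite (Dm _ _ nx).
Qed.

Lemma small_scale (e : R) : 0 < e -> exists m, lam ^- m < e.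
Proof.
move=> e0; have lam0 : 0 < lam by rewrite (lt_trans _ lam1).
have : (fun n => lam^-1 ^+ n) @ \oo --> (0 : R).
  by apply: cvg_expr; rewrite ger0_norm ?invr_ge0 ?ltW// invf_lt1.
move=> /cvgrPdist_lt /(_ e e0) [m _ /(_ m (leqnn m))].
rewrite sub0r normrN ger0_norm ?exprn_ge0 ?invr_ge0 ?ltW// exprVn => me.
by exists m.
Qed.

Lemma open_agree (U : set X) x :
  open U -> U x -> exists m, forall y, agree m x y -> U y.
Proof.
rewrite openE => /(_ x) oU /oU.
rewrite /interior /= -nbhs_ballE => -[e /= e0 xU].
have [m me] := small_scale e0.
exists m.+1 => y xy; apply: xU; rewrite ballEmdist /=.
by apply: lt_trans me; apply/subshift_dist_lt => k; rewrite -ltnS; exact: xy.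
Qed.

Lemma agree_nbhs m (x : X) : nbhs x (agree m x).
Proof.
rewrite -nbhs_ballE; exists (lam ^- m) => /=.
  by rewrite invr_gt0 exprn_gt0// (lt_trans _ lam1).
move=> y; rewrite ballEmdist /= => /subshift_dist_lt xy i im.
by rewrite xy// ltnW.
Qed.

Lemma cylinder_open D : cylinder D -> open D.
Proof.
move=> [m Dm]; rewrite openE => x Dx; rewrite /interior.
by apply: filterS (agree_nbhs m x) => y /Dm <-.
Qed.

(** An open set is the increasing union of the cylinders V m of the points all
    of whose m-neighbours lie in it. *)
Lemma borel_cylinder :
  (measurable : set (set (borel X))) = <<s cylinder >>.
Proof.
apply/seteqP; split; last first.
  apply: smallest_sub; first exact: (sigma_algebra_measurable (borel X)).
  by move=> D /cylinder_open oD; exact: sub_sigma_algebra.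
apply: smallest_sub; first exact: smallest_sigma_algebra.
move=> U oU.
pose V m := [set x | forall y, agree m x y -> U y].
have -> : U = \bigcup_m V m.
  apply/seteqP; split=> [x Ux|x [m _ /(_ x)]].
    by have [m xm] := open_agree oU Ux; exists m.
  exact.
apply: sigma_algebra_bigcup => m; apply: sub_sigma_algebra; exists m => x y xy.
apply/propext; split=> h z.
  by move=> yz; apply: h => i im; rewrite xy// yz.
by move=> yz; apply: h => i im; rewrite -xy// yz.
Qed.

Lemma cylinder_measurable (D : set X) :
  cylinder D -> measurable (D : set (borel X)).
Proof. by move=> /cylinder_open oD; exact: sub_sigma_algebra. Qed.

Lemma sigma_measurable (B : set (borel X)) :
  measurable B -> measurable (sigma @^-1` B : set (borel X)).
Proof.
rewrite [X in X B -> _]borel_cylinder.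
apply: (smallest_sub
    (X := [set B | measurable (sigma @^-1` B : set (borel X))])).
  split => /=.
  - by rewrite preimage_set0.
  - by move=> A mA; rewrite setTD preimage_setC; exact: measurableC.
  - by move=> A mA; rewrite preimage_bigcup; exact: bigcup_measurable.
by move=> D cD; apply: cylinder_measurable; exact: cylinder_shift.
Qed.

Definition prefix_word m (x : X) : m.-tuple S := [tuple x i | i < m].

(** At a word that no point begins with, the value is an arbitrary point; in
    [code_weight] such words merely waste mass. *)
Definition word_point m (u : m.-tuple S) : X :=
  get [set x | prefix_word m x = u].

Lemma prefix_word_depends m : depends_on m (@prefix_word m).
Proof.
by move=> x y xy; apply: eq_from_tnth => i; rewrite !tnth_map tnth_ord_tuple xy.
Qed.

Lemma measurable_prefix_word m (u : m.-tuple S) :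
  measurable (@prefix_word m @^-1` [set u] : set (borel X)).
Proof.
exact: cylinder_measurable (cylinder_preimage _ (@prefix_word_depends m)).
Qed.

Lemma word_point_agree m x : agree m (word_point (prefix_word m x)) x.
Proof.
move=> i im.
have : prefix_word m (word_point (prefix_word m x)) = prefix_word m x.
  by apply: (@getPex _ [set y | prefix_word m y = prefix_word m x]); exists x.
move/(congr1 (fun u => tnth u (Ordinal im))).
by rewrite !tnth_map tnth_ord_tuple.
Qed.

(** Uniform continuity. The sets W m of points having an m-neighbour y around
    which g oscillates little are cylinders, to which the finite subcover
    applies. *)
Lemma continuous_oscillation (g : X -> R) (e : R) :
  continuous g -> 0 < e ->
  exists m, forall x y, agree m x y -> `|g x - g y| <= e.
Proof.
move=> cg e0.
pose V m := [set x | forall y, agree m x y -> `|g x - g y| <= e / 2].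
pose W m := [set x | exists2 y, V m y & agree m x y].
have cW m : cylinder (W m).
  exists m => x y xy; apply/propext; split=> -[z Vz az]; exists z => // i im.
    by rewrite -xy// az.
  by rewrite xy// az.
have [|N WN] := cylinder_finite_subcover cW.
  move=> x; have e20 : 0 < e / 2 by rewrite divr_gt0.
  have xoU : \forall y \near x, `|g x - g y| < e / 2.
    by move/cvgrPdist_lt : (cg x) => /(_ _ e20).
  have [m xm] := open_agree (open_interior _) xoU.
  exists m, x => // y xy; apply/ltW.
  by move: (xm _ xy); apply: interior_subset.
exists N => x y xy; have [i iN [z Vz xz]] := WN x.
rewrite -(subrKA (g z)) (splitr e) (le_trans (ler_normD _ _))// lerD//.
  by rewrite distrC; apply: Vz; exact: agree_sym.
by apply: Vz => k ki; rewrite -xz// xy// (leq_trans ki)// ltnW.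
Qed.

Lemma hoelder_continuous_continuous alpha (A : X -> R) :
  0 < alpha -> hoelder_continuous alpha A -> continuous A.
Proof.
move=> a0 [C AC] x; apply/(@cvgrPdist_lt _ _ _ (nbhs x)) => e e0.
pose K := `|C| + 1.
have K0 : 0 < K by rewrite ltr_pwDr.
have lam0 : 0 < lam by rewrite (lt_trans _ lam1).
have [m me] : exists m, (lam ^- m) `^ alpha < e / K.
  have eK0 : 0 < (e / K) `^ alpha^-1 by rewrite powR_gt0 ?divr_gt0.
  have [m me] := small_scale eK0.
  exists m; have := @gt0_ltr_powR _ alpha a0 (lam ^- m) ((e / K) `^ alpha^-1).
  rewrite -powRrM mulVf ?gt_eqF// powRr1 ?divr_ge0 ?ltW//; apply => //.
    by rewrite nnegrE invr_ge0 exprn_ge0// ltW.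
  by rewrite nnegrE powR_ge0.
have := agree_nbhs m.+1 x; apply: filterS => y xy.
rewrite (le_lt_trans (AC x y))//.
have dm : mdist x y `^ alpha < e / K.
  apply: le_lt_trans me; apply: ge0_ler_powR; rewrite ?ltW//.
  - by rewrite nnegrE mdist_ge0.
  - by rewrite nnegrE invr_ge0 exprn_ge0// ltW.
  - apply/subshift_dist_lt => k; rewrite -ltnS; exact: xy.
rewrite (@le_lt_trans _ _ (K * mdist x y `^ alpha))//.
  by rewrite ler_wpM2r ?powR_ge0// (le_trans (ler_norm C))// lerDl.
by rewrite -ltr_pdivlMl// mulrC.
Qed.

End cylinders.

(** * Approximation of partitions by cylinders *)

Section approximation.
Context {R : realType} {S : finType} {M : rel S}.
Context {M0 : exists x, admissible M x} {lam : R} {lam1 : 1 < lam}.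
Local Notation X := (subshift M0 lam1).
Variable mu : probability (borel X) R.

(** The sets approximable by cylinders form a sigma-algebra; countable unions
    are handled through finite ones, by continuity from below. *)
Lemma cylinder_dense (B : set (borel X)) (e : R) : measurable B -> 0 < e ->
  exists2 D : set X, cylinder D & (mu (B `+` D) <= e%:E)%E.
Proof.
pose G : set (set X) := [set B | measurable (B : set (borel X)) /\
  forall e, 0 < e ->
    exists2 D : set X, cylinder D & (mu (B `+` D) <= e%:E)%E].
have mY (A D : set X) : measurable (A : set (borel X)) -> cylinder D ->
    measurable (A `+` D : set (borel X)).
  move=> mA /cylinder_measurable mD.
  by apply: measurableU; apply: measurableD.
have cover (A E F : set X) (a b : R) : measurable (A : set (borel X)) ->
    measurable (E : set (borel X)) -> measurable (F : set (borel X)) ->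
    A `<=` E `|` F -> (mu E <= a%:E)%E -> (mu F <= b%:E)%E ->
    (mu A <= (a + b)%:E)%E.
  move=> mA mE mF AEF Ea Fb.
  apply: (@le_trans _ _ (mu (E `|` F))).
    by apply: le_measure => //; rewrite inE//; exact: measurableU.
  by apply: (le_trans (measureU2 _ mE mF)); rewrite EFinD leeD.
have G0 : G set0.
  split=> // a a0; exists set0; first exact: cylinder0.
  by rewrite setYK measure0 lee_fin ltW.
have GU (A E : set X) : G A -> G E -> G (A `|` E).
  move=> [mA GA] [mE GE]; split; first exact: measurableU.
  move=> a a0; have a20 : 0 < a / 2 by rewrite divr_gt0.
  have [D cD AD] := GA _ a20; have [F cF EF] := GE _ a20.
  exists (D `|` F); first exact: cylinderU.
  rewrite (splitr a); apply: (cover _ (A `+` D) (E `+` F)) => //.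
  - by apply: mY; [exact: measurableU|exact: cylinderU].
  - exact: mY.
  - exact: mY.
  - move=> x [[[Ax|Ex] /not_orP[nD nF]]|[[Dx|Fx] /not_orP[nA nE]]].
    + by left; left.
    + by right; left.
    + by left; right.
    + by right; right.
suff : <<s cylinder >> `<=` G.
  by move=> /(_ B); rewrite -borel_cylinder => h /h [_] /(_ e); apply.
apply: smallest_sub; last first.
  move=> D cD; split; first exact: cylinder_measurable.
  by move=> a a0; exists D => //; rewrite setYK measure0 lee_fin ltW.
split=> //.
  move=> A [mA GA]; rewrite setTD; split; first exact: measurableC.
  move=> a /GA[D cD AD]; exists (~` D); first exact: cylinderC.
  suff -> : ~` A `+` ~` D = A `+` D by [].
  rewrite /setY !setDE !setCK setIC [A `&` ~` D]setIC setUC.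
  by rewrite ![_ `&` ~` _]setIC.
move=> F GF.
(* The finite unions H n exhaust the countable one; H N is approximated instead. *)
pose H n : set X := \big[setU/set0]_(i < n) F i.
have GH n : G (H n).
  elim: n => [|n ih]; first by rewrite /H big_ord0.
  by rewrite /H big_ord_recr/=; exact: GU.
have mF : measurable (\bigcup_i F i : set (borel X)).
  by apply: bigcup_measurable => i _; exact: (GF i).1.
split=> // a a0; have a20 : 0 < a / 2 by rewrite divr_gt0.
have HF : \bigcup_n (H n) = \bigcup_n (F n).
  apply/seteqP; split=> [x [n _]|x].
    by rewrite /H -bigcup_mkord => -[i _ Fx]; exists i.
  by rewrite -bigcup_bigsetU_bigcup => -[n _ Hx]; exists n.+1.
have Hcvg : mu (H n) @[n --> \oo] --> mu (\bigcup_n H n).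
  apply: nondecreasing_cvg_mu => //.
  - by move=> n; exact: (GH n).1.
  - by rewrite HF.
  - by move=> i j ij; apply/subsetPset; exact: subset_bigsetU.
have fF : mu (\bigcup_n F n) = (fine (mu (\bigcup_n F n)))%:E.
  by rewrite fineK// fin_num_measure.
rewrite HF fF in Hcvg.
have fH : fine (mu (H n)) @[n --> \oo] --> fine (mu (\bigcup_n F n)).
  exact: fine_cvg.
move/cvgrPdist_le : fH => /(_ _ a20)[N _ /(_ N (leqnn N)) HN].
have HNF : H N `<=` \bigcup_n F n by rewrite -HF; exact: bigcup_sup.
have mH : measurable (H N : set (borel X)) := (GH N).1.
have [D cD HD] := (GH N).2 _ a20.
exists D => //; rewrite (splitr a).
apply: (cover _ (\bigcup_n F n `\` H N) (H N `+` D)) => //.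
- exact: mY.
- exact: measurableD.
- exact: mY.
- move=> x [[Fx nD]|[Dx nF]].
    by have [Hx|nH] := pselect (H N x); [right; left|left].
  by right; right; split => // /HNF.
- rewrite measureD ?(setIidr HNF) ?ltey_eq ?fin_num_measure//.
  rewrite -[X in (X - _)%E]fineK ?fin_num_measure//.
  rewrite -[X in (_ - X)%E]fineK ?fin_num_measure// -EFinB lee_fin.
  exact: le_trans (ler_norm _) HN.
Qed.

(** Let p' x be the index i of some cylinder D i containing x, where D i
    approximates the i-th cell; p and p' agree outside the union of the
    symmetric differences. *)
Lemma partition_cylinder_approx k (p : X -> 'I_k) (e : R) :
  measurable_partition p -> 0 < e ->
  exists m (p' : X -> 'I_k), [/\ depends_on m p',
    measurable ([set x | p x != p' x] : set (borel X)) &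
    (mu [set x | p x != p' x] <= e%:E)%E].
Proof.
move=> mp e0.
have k0 : 0 < k%:R :> R.
  by rewrite ltr0n; apply: leq_ltn_trans (ltn_ord (p point)).
have ek0 : 0 < e / k%:R by rewrite divr_gt0.
have /choice[D /all_and2[cD De]] : forall i, exists D : set X,
    cylinder D /\ (mu (p @^-1` [set i] `+` D) <= (e / k%:R)%:E)%E.
  by move=> i; have [D] := cylinder_dense (mp i) ek0; exists D.
have /choice[m_ mD] := cD.
pose m := (\max_i m_ i)%N.
pose p' x := odflt (p point) [pick i | `[< D i x >]].
have p'm : depends_on m p'.
  move=> x y xy; rewrite /p'; congr odflt; apply: eq_pick => i.
  rewrite (mD i x y)//; apply: agreeW xy; exact: leq_bigmax.
have mp' i : measurable (p' @^-1` [set i] : set (borel X)).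
  by apply: cylinder_measurable; exact: cylinder_preimage p'm.
have mE : measurable ([set x | p x != p' x] : set (borel X)).
  rewrite [X in measurable X](_ : _ =
      \bigcup_(i in [set: 'I_k]) (p @^-1` [set i] `\` p' @^-1` [set i])).
    apply: fin_bigcup_measurable; first exact: finite_finset.
    by move=> i _; apply: measurableD.
  apply/seteqP; split=> [x /= /eqP pp'|x [i _ [/= <-]] /nesym/eqP //].
  by exists (p x) => //; split => //= /esym.
exists m, p'; split => //.
apply: (@le_trans _ _ (\sum_i mu (p @^-1` [set i] `+` D i))%E).
  apply: measure_le_sum => //.
    move=> i; apply: measurableU; apply: measurableD => //;
      exact: cylinder_measurable.
  move=> x /= /eqP pp'; apply: contrapT => noi; apply: pp'.
  have pD i : D i x <-> p x = i.
    split=> [Dx|px]; apply: contrapT => h; apply: noi; exists i => //.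
      by right; split.
    by left; split.
  rewrite /p'; case: pickP => [i /asboolP/pD//|/(_ (p x))/asboolP[]].
  by apply/pD.
apply: (@le_trans _ _ (\sum_(i < k) (e / k%:R)%:E)%E).
  by apply: lee_sum => i _; exact: De.
by rewrite sumEFin sumr_const card_ord -[_ *+ k]mulr_natr divfK ?gt_eqF.
Qed.

End approximation.

(** * A uniform bound for the metric entropy *)

Section noisy_channel.
Context {R : realType} {k : nat}.

(** A noisy channel transmitting the symbol b: with probability 1/2 it outputs
    b, otherwise a uniformly random symbol. A correct transmission thus costs
    at most ln 2, and an error at most ln 2 + ln k. *)
Definition channel (a b : 'I_k) : R := (2 * k%:R)^-1 + (a == b)%:R / 2.

Lemma channel_gt0 a b : 0 < channel a b.
Proof.
have k0 : (0 < k)%N by apply: leq_ltn_trans (ltn_ord a).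
by rewrite ltr_wpDr ?divr_ge0// invr_gt0 mulr_gt0// ltr0n.
Qed.

Lemma channel_sum b : \sum_a channel a b = 1.
Proof.
have k0 : (0 < k)%N by apply: leq_ltn_trans (ltn_ord b).
rewrite big_split/= sumr_const card_ord -mulr_suml.
rewrite (bigD1 b)//= eqxx big1; last first.
  by move=> i /negbTE ->.
rewrite -[_ *+ k]mulr_natr addr0 mulr1n; field.
by rewrite pnatr_eq0 -lt0n.
Qed.

Lemma channel_cost a b : - ln (channel a b) <= ln 2 + ln k%:R * (a != b)%:R.
Proof.
have k0 : (0 < k)%N by apply: leq_ltn_trans (ltn_ord b).
have k0' : (0 : R) < k%:R by rewrite ltr0n.
rewrite /channel; case: eqP => _ /=.
  rewrite mulr0 addr0 lerNl -lnV ?posrE// ler_ln ?posrE ?invr_gt0//.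
    by rewrite mul1r lerDr invr_ge0 mulr_ge0.
by rewrite mul0r addr0 mulr1 lnV ?posrE ?mulr_gt0// opprK lnM ?posrE.
Qed.

Lemma channel_words n (b : 'I_n -> 'I_k) :
  \sum_(w : n.-tuple 'I_k) \prod_(i < n) channel (tnth w i) (b i) = 1.
Proof.
rewrite (reindex (@tuple_of_finfun 'I_k n)); last first.
  exists (@finfun_of_tuple 'I_k n) => w _.
    exact: tuple_of_finfunK.
  exact: finfun_of_tupleK.
under eq_bigr => w _ do under eq_bigr => i _ do rewrite tnth_map tnth_ord_tuple.
rewrite -(bigA_distr_bigA (fun i a => channel a (b i))).
by rewrite big1// => i _; exact: channel_sum.
Qed.

End noisy_channel.

Section entropy_bound.
Context {R : realType} {S : finType} {M : rel S}.
Context {M0 : exists x, admissible M x} {lam : R} {lam1 : 1 < lam}.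
Local Notation X := (subshift M0 lam1).
Local Notation sigma := (shift_map M0 lam1).
Variable mu : probability (borel X) R.
Hypothesis mu_inv : invariant_measure sigma mu.

Lemma invariant_iter n (B : set (borel X)) : measurable B ->
  measurable (iter n sigma @^-1` B : set (borel X)) /\
  mu (iter n sigma @^-1` B) = mu B.
Proof.
elim: n B => [//|n ih] B mB.
have [mn en] := ih _ (sigma_measurable mB).
by split; [exact: mn|rewrite -(mu_inv mB); exact: en].
Qed.

Lemma card_alphabet_gt0 : (0 < #|S|)%N.
Proof. by apply/card_gt0P; exists ((point : X) 0%N). Qed.

Section code.
Context {k : nat} (p p' : X -> 'I_k) (m n : nat).

Definition itinerary (x : X) : n.-tuple 'I_k :=
  [tuple p (iter i sigma x) | i < n].

(** The law of the random word obtained by drawing u uniformly among the words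
    of length n + m and sending the p'-itinerary that u determines through the
    noisy channel. *)
Definition code_weight (w : n.-tuple 'I_k) : R :=
  \sum_(u : (n + m).-tuple S) (#|S| ^ (n + m))%:R^-1 *
    \prod_(i < n) channel (tnth w i) (p' (iter i sigma (word_point u))).

Let N0 : 0 < (#|S| ^ (n + m))%:R :> R.
Proof. by rewrite ltr0n expn_gt0 card_alphabet_gt0. Qed.

Let term_gt0 w (u : (n + m).-tuple S) : 0 < (#|S| ^ (n + m))%:R^-1 *
    \prod_(i < n) channel (tnth w i) (p' (iter i sigma (word_point u))) :> R.
Proof.
by rewrite mulr_gt0 ?invr_gt0// prodr_gt0// => i _; exact: channel_gt0.
Qed.

Lemma code_weight_gt0 w : 0 < code_weight w.
Proof.
rewrite /code_weight (bigD1 (prefix_word (n + m) (point : X)))//=.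
by rewrite ltr_wpDr// sumr_ge0// => u _; exact: ltW.
Qed.

Lemma code_weight_sum : \sum_w code_weight w = 1.
Proof.
rewrite /code_weight exchange_big/=.
under eq_bigr => u _ do rewrite -mulr_sumr channel_words mulr1.
by rewrite sumr_const card_tuple -[_ *+ _]mulr_natr mulVf ?gt_eqF.
Qed.

(** The term of [code_weight] coming from the word u that x itself begins with
    already gives the bound: u costs (n + m) ln #|S|, and then each time step
    costs ln 2, plus ln k if p and p' differ there. *)
Lemma code_length x : depends_on m p' ->
  - ln (code_weight (itinerary x)) <=
    (n + m)%:R * ln #|S|%:R +
    \sum_(i < n) (ln 2 + ln k%:R *
      (p (iter i sigma x) != p' (iter i sigma x))%:R).
Proof.
move=> p'm; set u := prefix_word (n + m) x.
have le_code : (#|S| ^ (n + m))%:R^-1 *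
    \prod_(i < n) channel (p (iter i sigma x)) (p' (iter i sigma x)) <=
    code_weight (itinerary x).
  rewrite /code_weight (bigD1 u)//= -[leLHS]addr0 lerD ?sumr_ge0//; last first.
    by move=> v _; exact: ltW.
  rewrite ler_wpM2l ?invr_ge0 ?ler0n// le_eqVlt; apply/orP; left; apply/eqP.
  apply: eq_bigr => i _; rewrite tnth_map tnth_ord_tuple; congr channel.
  (* At time i < n, the map p' sees the coordinates i, ..., i + m - 1 only. *)
  apply/esym/p'm/agree_iter.
  apply: agreeW (word_point_agree (m := n + m) x).
  by rewrite leq_add2r ltnW.
have prod0 : 0 <
    \prod_(i < n) channel (p (iter i sigma x)) (p' (iter i sigma x)) :> R.
  by rewrite prodr_gt0// => i _; exact: channel_gt0.
apply: (@le_trans _ _ (- ln ((#|S| ^ (n + m))%:R^-1 *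
    \prod_(i < n) channel (p (iter i sigma x)) (p' (iter i sigma x))))).
  by rewrite lerN2 ler_ln ?posrE ?mulr_gt0 ?invr_gt0 ?code_weight_gt0.
rewrite lnM ?posrE ?invr_gt0// lnV ?posrE// opprD opprK natrX.
rewrite lnXn ?ltr0n ?card_alphabet_gt0// mulr_natl lerD//.
rewrite (_ : ln _ = \sum_(i < n)
    ln (channel (p (iter i sigma x)) (p' (iter i sigma x)))); last first.
  apply: (big_morph_in (Num.pos : {pred R}) (@ln R)).
  - by move=> y z; exact: rpredM.
  - exact: rpred1.
  - exact: lnM.
  - exact: ln1.
  - by move=> i _; rewrite posrE; exact: channel_gt0.
by rewrite -sumrN; apply: ler_sum => i _; exact: channel_cost.
Qed.

End code.

(** By Gibbs' inequality the entropy is at most the mean of the bound in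
    [code_length], and by invariance the n error events have the same probability. *)
Lemma join_entropy_le k (p p' : X -> 'I_k) m n (e : R) :
  measurable_partition p -> depends_on m p' ->
  measurable ([set x | p x != p' x] : set (borel X)) ->
  (mu [set x | p x != p' x] <= e%:E)%E ->
  join_entropy sigma mu p n <=
    (n + m)%:R * ln #|S|%:R + n%:R * (ln 2 + ln k%:R * e).
Proof.
move=> mp p'm mE muE.
pose b i x := p (iter i sigma x) != p' (iter i sigma x).
have cellE w : join_cell sigma p w = itinerary p n @^-1` [set w].
  apply/seteqP; split=> [x xw|x <- i]; last by rewrite tnth_map tnth_ord_tuple.
  by apply: eq_from_tnth => i; rewrite tnth_map tnth_ord_tuple; exact: xw.
have mcell w : measurable (itinerary p n @^-1` [set w] : set (borel X)).
  rewrite -cellE (_ : join_cell _ _ _ = \bigcap_(i in [set: 'I_n])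
      (iter i sigma @^-1` (p @^-1` [set tnth w i]))); last first.
    by apply/seteqP; split=> [x xw i _|x xw i]; exact: xw.
  apply: fin_bigcap_measurable; first exact: finite_finset.
  by move=> i _; exact: (invariant_iter i (mp _)).1.
have mb i c : measurable (b i @^-1` [set c] : set (borel X)).
  have mt : measurable (b i @^-1` [set true] : set (borel X)).
    rewrite (_ : _ @^-1` _ = iter i sigma @^-1` [set x | p x != p' x]).
      exact: (invariant_iter i mE).1.
    by apply/seteqP; split=> x.
  case: c => //; rewrite (_ : _ @^-1` _ = ~` (b i @^-1` [set true])).
    exact: measurableC.
  by apply/seteqP; split=> x /=; case: (b i x).
have mub i : fine (mu (b i @^-1` [set true])) <= e.
  rewrite -lee_fin fineK ?fin_num_measure//.
  by rewrite (invariant_iter i mE).2.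
rewrite /join_entropy.
under eq_bigr => w _ do rewrite cellE.
have gibbs := @gibbs_inequality R _
  (fun w => fine (mu (itinerary p n @^-1` [set w])))
  (code_weight p' m (n := n)).
apply: (le_trans (gibbs _ _ _ _)).
- by move=> w; exact: fine_ge0.
- exact: code_weight_gt0.
- exact: label_mass.
- by rewrite code_weight_sum.
rewrite -sumrN.
under eq_bigr => w _ do rewrite -mulrN mulrC.
rewrite -(Rintegral_label mu mcell (fun w => - ln (code_weight p' m w))).
pose psi (c : bool) : R := ln 2 + ln k%:R * c%:R.
have ipsi i : mu.-integrable [set: borel X] (EFin \o (psi \o b i)).
  exact: integrable_label.
have [isum sumE] := Rintegral_sum (fun i : 'I_n => ipsi i).
have icst : mu.-integrable [set: borel X]
    (EFin \o (fun=> (n + m)%:R * ln #|S|%:R)).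
  exact: finite_measure_integrable_cst.
apply: (@le_trans _ _ (\int[mu]_x ((n + m)%:R * ln #|S|%:R +
    \sum_(i < n) psi (b i x)))).
  apply: le_Rintegral => //.
  - exact: (integrable_label mu mcell (fun w => - ln (code_weight p' m w))).
  - have := integrableD measurableT icst isum.
    by apply: eq_integrable => // x _ /=.
  - by move=> x _; exact: code_length.
rewrite RintegralD// sumE Rintegral_cst// [X in _ * fine X]probability_setT.
rewrite mulr1 lerD2l.
have -> : n%:R * (ln 2 + ln k%:R * e) = \sum_(i < n) (ln 2 + ln k%:R * e).
  by rewrite sumr_const card_ord mulr_natl.
apply: ler_sum => i _; rewrite (Rintegral_label mu (mb i) psi).
have := label_mass mu (mb i); rewrite !big_bool /psi /= => mass.
have k1 : (0 < k)%N by apply: leq_ltn_trans (ltn_ord (p point)).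
rewrite mulr1 mulr0 addr0 mulrDl addrAC -mulrDr mass mulr1 lerD2l.
by rewrite ler_wpM2l// ln_ge0// ler1n.
Qed.

(** The approximation error is chosen so small that errors cost at most 1 per
    time step, and n + m <= 2 n once n is large. The maximum with [point]
    covers sequences without a limit, whose [limn] is [point]; subadditivity
    is thereby bypassed. *)
Lemma partition_entropy_le k (p : X -> 'I_k) : measurable_partition p ->
  partition_entropy sigma mu p <=
    Num.max point (2 * ln #|S|%:R + ln 2 + 1).
Proof.
move=> mp; rewrite le_max; apply/orP.
have k1 : (0 < k)%N by apply: leq_ltn_trans (ltn_ord (p point)).
have lnk : 0 <= ln k%:R :> R by rewrite ln_ge0// ler1n.
have e0 : 0 < (1 + ln k%:R)^-1 :> R by rewrite invr_gt0 ltr_pwDl.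
have [m [p' [p'm mE muE]]] := partition_cylinder_approx mu mp e0.
rewrite /partition_entropy; set u := (X in limn X).
have [cu|/dvgP ->] := pselect (cvgn u); [right|by left].
apply: limr_le => //; near=> n.
have n0 : 0 < n%:R :> R by rewrite ltr0n; near: n; exact: nbhs_infty_gt.
have mn : m%:R <= n%:R :> R.
  by rewrite ler_nat; near: n; exact: nbhs_infty_ge.
rewrite /u ler_pdivrMr// (le_trans (join_entropy_le n mp p'm mE muE))//.
have lnS : 0 <= ln #|S|%:R :> R by rewrite ln_ge0// ler1n card_alphabet_gt0.
have ke : ln k%:R * (1 + ln k%:R)^-1 <= 1 :> R.
  by rewrite ler_pdivrMr ?mul1r ?lerDr// ltr_pwDl.
rewrite natrD.
have : (n%:R + m%:R) * ln #|S|%:R <= (n%:R + n%:R) * ln #|S|%:R :> R.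
  by rewrite ler_wpM2r// lerD2l.
have : n%:R * (ln 2 + ln k%:R * (1 + ln k%:R)^-1) <= n%:R * (ln 2 + 1) :> R.
  by rewrite ler_pM2l// lerD2l.
lra.
Unshelve. all: by end_near. Qed.

Lemma metric_entropy_le :
  (metric_entropy sigma mu <=
    (Num.max point (2 * ln #|S|%:R + ln 2 + 1))%:E)%E.
Proof.
apply: ge_ereal_sup => _ [k [p [mp ->]]].
by rewrite lee_fin; exact: partition_entropy_le.
Qed.

End entropy_bound.

(** * Ultralimits of probability measures *)

(** A copy of the subshift whose measurable sets are the cylinders only: the
    algebra from which a measure is extended to all Borel sets. *)
Definition cylinder_space (R : realType) (S : finType) (M : rel S)
  (M0 : exists x, admissible M x) (lam : R) (lam1 : 1 < lam) := subshift M0 lam1.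

Section cylinder_algebra.
Context {R : realType} {S : finType} {M : rel S}.
Context {M0 : exists x, admissible M x} {lam : R} {lam1 : 1 < lam}.

HB.instance Definition _ := Pointed.on (cylinder_space M0 lam1).
HB.instance Definition _ := isAlgebraOfSets.Build default_measure_display
  (cylinder_space M0 lam1) (@cylinder0 R S M M0 lam lam1)
  (@cylinderU R S M M0 lam lam1) (@cylinderC R S M M0 lam lam1).

End cylinder_algebra.

Section ultralimit.
Context {R : realType} {S : finType} {M : rel S}.
Context {M0 : exists x, admissible M x} {lam : R} {lam1 : 1 < lam}.
Local Notation X := (subshift M0 lam1).
Local Notation Y := (cylinder_space M0 lam1).
Context {T : Type} {U : set_system T} (UU : UltraFilter U).
Variable mu : T -> probability (borel X) R.

(** Values of [mu t] on non-measurable sets are arbitrary; the truncation at 1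
    keeps the limit meaningful for all [D] and is harmless on measurable
    sets. *)
Definition ultralimit (D : set Y) : \bar R :=
  (lim (Num.min 1 (fine (mu t D)) @[t --> U]))%:E.

Let mass01 (D : set X) t : 0 <= Num.min 1 (fine (mu t D)) <= 1.
Proof. by rewrite le_min ler01 fine_ge0//= ge_min lexx. Qed.

Lemma ultralimit_cvg (D : set X) : measurable (D : set (borel X)) ->
  fine (mu t D) @[t --> U] --> fine (ultralimit D).
Proof.
move=> mD; rewrite /ultralimit [X in X @ U --> _](_ : _ =
    (fun t => Num.min 1 (fine (mu t D)))).
  exact: ultra_bounded_cvg (mass01 D).
apply/funext => t; apply/esym/min_idPr.
rewrite -lee_fin fineK ?fin_num_measure//.
exact: probability_le1.
Qed.

Lemma ultralimitE (D : set X) (l : R) : measurable (D : set (borel X)) ->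
  fine (mu t D) @[t --> U] --> l -> ultralimit D = l%:E.
Proof.
move=> mD Dl; rewrite -(@fineK _ (ultralimit D))//; congr EFin.
exact: cvg_unique (ultralimit_cvg mD) Dl.
Qed.

Let ultralimit0 : ultralimit set0 = 0%E.
Proof.
apply: ultralimitE => //.
by under eq_fun do rewrite measure0; exact: cvg_cst.
Qed.

Let ultralimit_ge0 D : (0 <= ultralimit D)%E.
Proof.
rewrite lee_fin; apply: limr_ge; first exact: ultra_bounded_cvg (mass01 D).
by apply: nearW => t; have /andP[] := mass01 D t.
Qed.

Let ultralimitU (D E : set X) : cylinder D -> cylinder E -> D `&` E = set0 ->
  ultralimit (D `|` E) = (ultralimit D + ultralimit E)%E.
Proof.
move=> /cylinder_measurable mD /cylinder_measurable mE DE0.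
rewrite -(@fineK _ (ultralimit D))// -(@fineK _ (ultralimit E))// -EFinD.
apply: ultralimitE; first exact: measurableU.
rewrite (_ : (fun t => _) = (fun t => fine (mu t D) + fine (mu t E))).
  by apply: cvgD; exact: ultralimit_cvg.
by apply/funext => t; rewrite measureU// fineD ?fin_num_measure.
Qed.

Let ultralimit_bigU (F : (set Y)^nat) n : (forall i, cylinder (F i)) ->
  trivIset setT F ->
  ultralimit (\big[setU/set0]_(i < n) F i) = (\sum_(i < n) ultralimit (F i))%E.
Proof.
move=> cF tF; elim: n => [|n ih]; first by rewrite !big_ord0.
rewrite !big_ord_recr/= ultralimitU ?ih//.
  elim: (n) => [|k ck]; first by rewrite big_ord0; exact: cylinder0.
  by rewrite big_ord_recr; exact: cylinderU.
rewrite -bigcup_mkord setI_bigcupl; apply/bigcup0P => i /= lti.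
apply/eqP/negPn/negP => /set0P h.
by have /eqP := tF _ _ I I h; rewrite ltn_eqF.
Qed.

(** By compactness, a cylinder that is a disjoint union of cylinders is the
    union of finitely many of them, so sigma-additivity reduces to
    additivity. *)
Let ultralimit_sigma_additive : semi_sigma_additive ultralimit.
Proof.
move=> F cF tF cUF.
(* Adding the complement of the union turns F into a cover of the whole space. *)
pose G i := if i is j.+1 then F j else ~` (\bigcup_i F i).
have [||N GN] := @cylinder_finite_subcover R S M M0 lam lam1 G.
- by case=> [|i]; [exact: cylinderC|exact: cF].
- move=> x; have [[i _ Fx]|nF] := pselect ((\bigcup_i F i) x).
    by exists i.+1.
  by exists 0%N.
apply: cvg_near_cst; exists N => // n /= Nn.
rewrite big_mkord -ultralimit_bigU//; congr ultralimit.
rewrite -bigcup_mkord; apply/seteqP; split=> x [i].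
  by move=> _ Fx; exists i.
move=> _ Fx; have [[|j] jN Gx] := GN x; first by exfalso; apply: Gx; exists i.
by exists j => //=; rewrite (leq_trans _ Nn)// ltnW.
Qed.

HB.instance Definition _ := isMeasure.Build _ Y R ultralimit
  ultralimit0 ultralimit_ge0 ultralimit_sigma_additive.

(** The Caratheodory extension lives on the sigma-algebra generated by
    cylinders, which is the Borel one. *)
Definition ultralimit_ext (B : set (borel X)) : \bar R :=
  measure_extension ultralimit B.

Let ext_cylinder (D : set X) : cylinder D -> ultralimit_ext D = ultralimit D.
Proof. by move=> cD; apply: (@measurable_mu_extE _ R Y ultralimit). Qed.

Let ext0 : ultralimit_ext set0 = 0%E. Proof. exact: measure0. Qed.

Let ext_ge0 B : (0 <= ultralimit_ext B)%E. Proof. exact: measure_ge0. Qed.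

Let ext_sigma_additive : semi_sigma_additive ultralimit_ext.
Proof.
move=> F; rewrite borel_cylinder => mF tF mUF.
exact: (@measure_semi_sigma_additive _ _ _ (measure_extension ultralimit)).
Qed.

HB.instance Definition _ := isMeasure.Build _ (borel X) R ultralimit_ext
  ext0 ext_ge0 ext_sigma_additive.

Let ext_setT : ultralimit_ext setT = 1%E.
Proof.
rewrite ext_cylinder; last exact: cylinderT.
apply: ultralimitE => //.
by under eq_fun do rewrite probability_setT; exact: cvg_cst.
Qed.

HB.instance Definition _ :=
  Measure_isProbability.Build _ _ _ ultralimit_ext ext_setT.

(** Weak* compactness of the space of probabilities, in ultrafilter form. *)
Lemma ultralimit_probability :
  exists nu : probability (borel X) R, forall D : set X, cylinder D ->
    fine (mu t D) @[t --> U] --> fine (nu D).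
Proof.
exists ultralimit_ext => D cD; rewrite /= ext_cylinder//.
by apply: ultralimit_cvg; exact: cylinder_measurable.
Qed.

End ultralimit.

Section weak_limits.
Context {R : realType} {S : finType} {M : rel S}.
Context {M0 : exists x, admissible M x} {lam : R} {lam1 : 1 < lam}.
Local Notation X := (subshift M0 lam1).
Local Notation sigma := (shift_map M0 lam1).

Lemma continuous_integrable (mu : probability (borel X) R) (g : X -> R) :
  continuous g -> mu.-integrable [set: borel X] (EFin \o g).
Proof.
move=> cg; apply: probability_bounded_integrable.
  apply: (measurability _ (measurable_realfun.RGenOInfty.measurableE R)).
  move=> _ [_ [a ->] <-].
  rewrite setTI; apply: sub_sigma_algebra.
  by apply: open_comp => [x _|]; [exact: cg|exact: rray_open].
have [m gm] := continuous_oscillation cg ltr01.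
exists (1 + \sum_(u : m.-tuple S) `|g (word_point u)|) => x.
rewrite -[g x](subrK (g (word_point (prefix_word m x)))).
rewrite (le_trans (ler_normD _ _))// lerD//.
  by apply: gm; apply: agree_sym; exact: word_point_agree.
by rewrite (bigD1 (prefix_word m x))//= lerDl sumr_ge0.
Qed.

(** Replacing g by its value at a chosen point of each cylinder of depth m
    changes all integrals by at most e / 3, and turns them into finite sums of
    masses of cylinders. *)
Lemma Rintegral_ultralimit (T : Type) (U : set_system T)
    (mu : T -> probability (borel X) R) (nu : probability (borel X) R)
    (g : X -> R) :
  ProperFilter U ->
  (forall D : set X, cylinder D -> fine (mu t D) @[t --> U] --> fine (nu D)) ->
  continuous g -> \int[mu t]_x g x @[t --> U] --> \int[nu]_x g x.
Proof.
move=> PU cnu cg; apply/cvgrPdist_le => e e0.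
have e30 : 0 < e / 3 by rewrite divr_gt0.
have [m gm] := continuous_oscillation cg e30.
pose c (u : m.-tuple S) := g (word_point u).
pose J (mu : probability (borel X) R) :=
  \sum_u c u * fine (mu (prefix_word m @^-1` [set u])).
have JE (rho : probability (borel X) R) : `|\int[rho]_x g x - J rho| <= e / 3.
  rewrite /J -(Rintegral_label rho (@measurable_prefix_word _ _ _ _ _ _ m) c).
  apply: Rintegral_near; first exact: continuous_integrable.
    exact: (integrable_label rho (@measurable_prefix_word _ _ _ _ _ _ m) c).
  move=> x; apply: gm; apply: agree_sym; exact: word_point_agree.
have : J (mu t) @[t --> U] --> J nu.
  apply: cvg_big => [|u _]; first exact: add_continuous.
  apply: cvgM; first exact: cvg_cst.
  exact: cnu _ (cylinder_preimage _ (@prefix_word_depends _ _ _ _ _ _ m)).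
move/cvgrPdist_le => /(_ _ e30); apply: filterS => t Jt.
have := JE nu; have := JE (mu t).
rewrite !ler_norml => /andP[a1 a2] /andP[b1 b2].
move: Jt; rewrite ler_norml => /andP[c1 c2].
apply/andP; split; lra.
Qed.

(** The shift as a map of measurable spaces, to form image measures. *)
Definition borel_shift : borel X -> borel X := sigma.

Let measurable_borel_shift : measurable_fun [set: borel X] borel_shift.
Proof. by move=> _ B mB; rewrite setTI; exact: sigma_measurable. Qed.

HB.instance Definition _ :=
  isMeasurableFun.Build _ _ _ _ borel_shift measurable_borel_shift.

(** Cylinders are stable under intersection and generate the Borel sets, so
    that they determine nu and its image under the shift. *)
Lemma invariant_cylinder (nu : probability (borel X) R) :
  (forall D : set X, cylinder D -> nu (sigma @^-1` D) = nu D) ->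
  invariant_measure sigma nu.
Proof.
move=> nuD B mB.
apply: (@measure_unique _ R (borel X) cylinder (fun=> setT) borel_cylinder _ _ _
  (pushforward nu borel_shift) nu) => //.
- exact: cylinderI.
- by move=> _; exact: cylinderT.
- by rewrite bigcup_const.
- move=> k; rewrite /= /pushforward preimage_setT.
  by rewrite [X in (X < _)%E]probability_setT ltry.
Qed.

Lemma ultralimit_invariant (T : Type) (U : set_system T)
    (mu : T -> probability (borel X) R) (nu : probability (borel X) R) :
  ProperFilter U -> (forall t, invariant_measure sigma (mu t)) ->
  (forall D : set X, cylinder D -> fine (mu t D) @[t --> U] --> fine (nu D)) ->
  invariant_measure sigma nu.
Proof.
move=> PU mu_inv cnu; apply: invariant_cylinder => D cD.
have mD := cylinder_measurable cD.
have mD' := sigma_measurable mD.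
rewrite -[LHS]fineK ?fin_num_measure// -[RHS]fineK ?fin_num_measure//.
congr EFin.
apply: (cvg_unique _ (cnu _ (cylinder_shift cD))); first exact: Rhausdorff.
rewrite (_ : (fun t => _) = (fun t => fine (mu t D))); first exact: cnu.
by apply/funext => t; congr fine; exact: mu_inv.
Qed.

End weak_limits.

(** * Zero-temperature limit *)

Section ground_states.
Context {R : realType} {S : finType} {M : rel S}.
Context {M0 : exists x, admissible M x} {lam : R} {lam1 : 1 < lam}.
Local Notation X := (subshift M0 lam1).
Local Notation sigma := (shift_map M0 lam1).

(** In the variational principle, mu competes with muA: its energy deficit is
    at most the gain in entropy divided by t. That gain is bounded, from above
    by [metric_entropy_le] and from below by the entropy of a trivial
    partition. *)
Lemma equilibrium_energy (A : X -> R) (muA : probability (borel X) R) :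
  maximizing_measure sigma A muA ->
  exists K : R, forall t mu, 0 < t -> equilibrium_state sigma A t mu ->
    \int[muA]_x A x - K / t <= \int[mu]_x A x.
Proof.
move=> [muA_inv _].
pose p (x : X) : 'I_1 := ord0.
pose h0 := partition_entropy sigma muA p.
have h0le : (h0%:E <= metric_entropy sigma muA)%E.
  apply: ereal_sup_ubound; exists 1%N, p; split=> // i.
  rewrite (_ : _ @^-1` _ = setT)//; apply/seteqP; split=> // x _ /=.
  by rewrite [i]ord1.
pose hmax := Num.max point (2 * ln #|S|%:R + ln 2 + 1) : R.
exists (hmax - h0) => t mu t0 [mu_inv mu_eq].
have : (metric_entropy sigma muA + (t * \int[muA]_x A x)%:E <=
    metric_entropy sigma mu + (t * \int[mu]_x A x)%:E)%E.
  by rewrite mu_eq; apply: ereal_sup_ubound; exists muA.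
move=> /(le_trans (leeD h0le (lexx _))) /le_trans.
move=> /(_ _ (leeD (metric_entropy_le mu_inv) (lexx _))).
rewrite -!EFinD lee_fin => h.
rewrite lerBlDr -(ler_pM2l t0) mulrDr mulrCA mulfV ?gt_eqF// mulr1.
by rewrite -/hmax in h; lra.
Qed.

(** Along U the error K / t of [equilibrium_energy] vanishes, so the limit
    measure inherits the maximal integral. *)
Lemma maximizing_ultralimit (A : X -> R) (muA nu : probability (borel X) R)
    (U : set_system R) (mu_hat : R -> probability (borel X) R) :
  UltraFilter U -> pinfty_nbhs R `<=` U -> continuous A ->
  (forall t : R, equilibrium_state sigma A t (mu_hat t)) ->
  maximizing_measure sigma A muA ->
  (forall D : set X, cylinder D ->
    fine (mu_hat t D) @[t --> U] --> fine (nu D)) ->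
  maximizing_measure sigma A nu.
Proof.
move=> UU ooU cA eqA maxA cnu.
have PU : ProperFilter U by exact: ultra_proper.
split; first by apply: ultralimit_invariant cnu => // t; have [] := eqA t.
move=> rho /(maxA.2 rho) /le_trans; apply.
have [K AK] := equilibrium_energy maxA.
apply/ler_addgt0Pr => e e0; rewrite -lerBlDr.
have cI := Rintegral_ultralimit PU cnu cA.
rewrite -(cvg_lim _ cI)//; apply: limr_ge; first exact: cvgP cI.
apply: ooU; exists (Num.max 0 (K / e)); split; first exact: num_real.
move=> t; rewrite gt_max => /andP[t0 Kt].
apply: le_trans (AK t _ t0 (eqA t)); rewrite lerD2l lerN2.
by rewrite ler_pdivrMr// mulrC -ler_pdivrMr// ltW.
Qed.

End ground_states.

Theorem propositionD (R : realType) (S : finType) (M : rel S)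
    (M0 : exists x, admissible M x) (lam : R) (lam1 : 1 < lam)
    (alpha : R) (A : subshift M0 lam1 -> R)
    (mu_hat : R -> probability (borel (subshift M0 lam1)) R)
    (muA : probability (borel (subshift M0 lam1)) R) :
  topologically_mixing (shift_map M0 lam1) ->
  0 < alpha <= 1 ->
  hoelder_continuous alpha A ->
  (forall t : R, equilibrium_state (shift_map M0 lam1) A t (mu_hat t)) ->
  unique_maximizing_measure (shift_map M0 lam1) A muA ->
  (forall x, 0 < A x) ->
  weakstar_cvg (pinfty_nbhs R) mu_hat muA.
Proof.
move=> _ /andP[alpha0 _] hA eqA [maxA uniqA] _ g cg.
have cA := hoelder_continuous_continuous alpha0 hA.
apply/cvgrPdist_lt => e e0; apply: contrapT => far.
(* The ultrafilter lives on the t's where the integrals stay e-apart. *)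
pose B := [set t | e <= `|\int[muA]_x g x - \int[mu_hat t]_x g x|].
have PB : ProperFilter (within B (pinfty_nbhs R)).
  split; last exact: within_filter.
  move=> noB; apply: far.
  apply: (@filterS _ (pinfty_nbhs R) _ _ _ _ noB) => t nB /=.
  by rewrite ltNge; apply/negP.
have [U [UU BU]] := ultraFilterLemma PB.
have PU : ProperFilter U by exact: ultra_proper.
have ooU : pinfty_nbhs R `<=` U.
  by move=> V V_oo; apply: BU; exact: cvg_within V_oo.
have UB : U B by apply: BU; exact: withinT.
have [nu cnu] := ultralimit_probability UU mu_hat.
have nuE := uniqA _ (maximizing_ultralimit UU ooU cA eqA maxA cnu).
have gE : \int[nu]_x g x = \int[muA]_x g x.
  rewrite /Rintegral; congr fine.
  by apply: eq_measure_integral => D mD _; exact: nuE.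
have := Rintegral_ultralimit PU cnu cg.
rewrite gE => /cvgrPdist_lt /(_ e e0) near_e.
have /filter_ex[t [/= + Bt]] : U ([set t |
    `|\int[muA]_x g x - \int[mu_hat t]_x g x| < e] `&` B) by exact: filterI.
by rewrite ltNge => /negP; apply.
Qed.
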